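(* Let $1\le p<\infty$, let $X$ be a compactly gauged cone in a Banach space $B$ with gauge $\langle\langle\cdot\rangle\rangle$, and let $\mathcal{F}\subset L^p(\mathbb{R}^d;X)$ be bounded, i.e., there is a uniform bound on $\langle\langle f\rangle\rangle_p$ for all $f\in\mathcal{F}$. Assume further that $\mathcal{F}$ is $L^p$-equivanishing and $L^p$-equicontinuous in $L^p(\mathbb{R}^d;B)$. Then $\mathcal{F}$ is totally bounded in $L^p(\mathbb{R}^d;B)$.
   Context: $\mathbb{R}^d$ carries Lebesgue measure. A function $f\colon \mathbb{R}^d \to B$ is Bochner measurable if it is the almost everywhere limit of a sequence of simple functions (functions taking finitely many values, each on a measurable set of finite measure). $L^p(\mathbb{R}^d;B)$ is the Bochner space of (classes of) Bochner measurable functions with $\|f\|_p = \left(\int_{\mathbb{R}^d}\|f(x)\|^p\,dx\right)^{1/p}<\infty$. A subset of a metric space is totally bounded if for every $\varepsilon>0$ it can be covered by finitely many sets of diameter less than $\varepsilon$; it is precompact if every sequence in it has a convergent subsequence (with limit not necessarily in the subset). A cone is a nonempty subset $X$ of a vector space such that $ax\in X$ whenever $a\in[0,\infty)$ and $x\in X$ (not necessarily convex). A gauge on a cone $X$ is a map $\langle\langle\cdot\rangle\rangle\colon X\to[0,\infty)$ such that $\langle\langle ax\rangle\rangle=a\langle\langle x\rangle\rangle$ for $x\in X$, $a\ge 0$, and $\langle\langle x\rangle\rangle>0$ if $x\neq 0$. A compactly gauged cone in a Banach space $B$ is a cone $X\subset B$ with a gauge such that $\{x\in X:\langle\langle x\rangle\rangle\le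 1\}$ is precompact in $B$. There is then a constant $C$ with $\|x\|\le C\langle\langle x\rangle\rangle$ for all $x\in X$. $L^p(\mathbb{R}^d;X)$ is the set of all functions $f\colon\mathbb{R}^d\to X$ such that $f$ is Bochner measurable as a function into $B$, the function $x\mapsto\langle\langle f(x)\rangle\rangle$ is measurable, and $\int_{\mathbb{R}^d}\langle\langle f(x)\rangle\rangle^p\,dx<\infty$. One writes $\langle\langle f\rangle\rangle_p=\left(\int_{\mathbb{R}^d}\langle\langle f(x)\rangle\rangle^p\,dx\right)^{1/p}$. A set $\mathcal{F}\subset L^p(\mathbb{R}^d;B)$ is $L^p$-equivanishing if $\int_{\{|x|>r\}}\|f(x)\|^p\,dx\to 0$ as $r\to\infty$, uniformly for $f\in\mathcal{F}$. It is $L^p$-equicontinuous if $\|\sigma_h f-f\|_p\to 0$ as $|h|\to 0$, uniformly for $f\in\mathcal{F}$, where $(\sigma_h f)(x)=f(x+h)$. *)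

(* Defs.v *)
From HB Require Import structures.
From mathcomp Require Import all_boot all_order all_algebra.
From mathcomp Require Import all_classical all_reals all_analysis.

Set Implicit Arguments.
Unset Strict Implicit.
Unset Printing Implicit Defensive.

Import Order.TTheory GRing.Theory Num.Theory.
Import numFieldNormedType.Exports.

Local Open Scope classical_set_scope.
Local Open Scope ring_scope.
Local Open Scope ereal_scope.

Section lebesgue_measure_cons.
Context {R : realType} (n : nat).
Local Notation T := (measurableTypeR R).

Definition tuple_cons (z : T * n.-tuple T) : n.+1.-tuple T :=
  [tuple of z.1 :: z.2].

Lemma measurable_tuple_cons : measurable_fun setT tuple_cons.
Proof. exact: measurable_cons. Qed.

HB.instance Definition _ :=
  isMeasurableFun.Build _ _ _ _ tuple_cons measurable_tuple_cons.

Variable m : {sigma_finite_measure set (n.-tuple T) -> \bar R}.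

Definition lebesgue_cons : set (n.+1.-tuple T) -> \bar R :=
  pushforward (lebesgue_measure \x m) tuple_cons.

Let lebesgue_cons0 : lebesgue_cons set0 = 0.
Proof. exact: measure0. Qed.

Let lebesgue_cons_ge0 A : 0 <= lebesgue_cons A.
Proof. exact: measure_ge0. Qed.

Let lebesgue_cons_sigma_additive : semi_sigma_additive lebesgue_cons.
Proof. exact: measure_semi_sigma_additive. Qed.

HB.instance Definition _ := isMeasure.Build _ _ _ lebesgue_cons
  lebesgue_cons0 lebesgue_cons_ge0 lebesgue_cons_sigma_additive.

Lemma lebesgue_cons_sigma_finite : sigma_finite setT lebesgue_cons.
Proof.
have /sigma_finiteP[F [FT ndF Foo]] := sigma_finiteT (@lebesgue_measure R).
have /sigma_finiteP[G [GT ndG Goo]] := sigma_finiteT m.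
pose u (t : n.+1.-tuple T) : T * n.-tuple T := (thead t, [tuple of behead t]).
have mu : measurable_fun setT u.
  apply/measurable_fun_pairP; split => /=; first exact: measurable_tnth.
  exact: measurable_behead.
have uK z : u (tuple_cons z) = z.
  by case: z => a t; congr pair => //; exact: val_inj.
exists (fun k => u @^-1` (F k `*` G k)).
  rewrite -preimage_bigcup (_ : \bigcup_k _ = setT) ?preimage_setT//.
  apply/seteqP; split => // -[a t] _.
  have [i _ Fia] : (\bigcup_k F k) a by rewrite -FT.
  have [j _ Gjt] : (\bigcup_k G k) t by rewrite -GT.
  exists (maxn i j) => //; split => /=.
    by move: a Fia; exact/subsetPset/ndF/leq_maxl.
  by move: t Gjt; exact/subsetPset/ndG/leq_maxr.
move=> k; have [mF Fk] := Foo k; have [mG Gk] := Goo k; split.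
  by rewrite -[X in measurable X]setTI; apply: mu => //; exact: measurableX.
rewrite /lebesgue_cons /pushforward -comp_preimage.
rewrite (_ : u \o tuple_cons = id) ?preimage_id; last exact/funext.
by rewrite product_measure1E// lte_mul_pinfty// ge0_fin_numE.
Qed.

HB.instance Definition _ :=
  Measure_isSigmaFinite.Build _ _ _ lebesgue_cons lebesgue_cons_sigma_finite.

End lebesgue_measure_cons.

Section euclidean_space.
Variable R : realType.
Local Notation T := (measurableTypeR R).

Fixpoint lebesgue_borel (d : nat) :
    {sigma_finite_measure set (d.-tuple T) -> \bar R} :=
  match d with
  | 0 => \d_([tuple] : 0.-tuple T)
  | d'.+1 => lebesgue_cons (lebesgue_borel d')
  end.

Variable d : nat.

(* R^d, as tuples, carrying the sigma-algebra of Lebesgue (not only Borel)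
   measurable sets: those that are Caratheodory measurable for the outer measure
   of the d-fold product of the Lebesgue measure of R. *)
Definition Rd := caratheodory_type ((lebesgue_borel d)^*)%mu.

HB.instance Definition _ := Measurable.on Rd.

Definition lebesgue_Rd : set Rd -> \bar R :=
  @completed_measure_extension _ _ _ (lebesgue_borel d).

HB.instance Definition _ := Measure.on lebesgue_Rd.

Definition translate (h x : Rd) : Rd :=
  [tuple (tnth x i + tnth h i)%R | i < d].

Definition euclidean_norm (x : Rd) : R :=
  Num.sqrt (\sum_(i < d) tnth x i ^+ 2)%R.

End euclidean_space.

Lemma lebesgue_borel_box (R : realType) (d : nat)
    (A : 'I_d -> set (measurableTypeR R)) : (forall i, measurable (A i)) ->
  lebesgue_borel R d [set x | forall i, A i (tnth x i)] =
  \prod_(i < d) lebesgue_measure (A i).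
Proof.
elim: d A => [A _|d IH A mA].
  rewrite big_ord0 /= diracE mem_set//= => -[]//.
rewrite big_ord_recl -IH// -product_measure1E//.
- rewrite /= /lebesgue_cons /pushforward; congr product_measure1.
  apply/seteqP; split => [[a t] /= At|[a t] [/= Aa At] i].
    split => [|i]; first by have := At ord0.
    by have := At (lift ord0 i); rewrite tnthS.
  by case: (unliftP ord0 i) => [j ->|->]//=; rewrite tnthS.
- rewrite (_ : [set _ | _] = \bigcap_(i in [set: 'I_d])
    ((@tnth d _ ^~ i) @^-1` A (lift ord0 i))); last first.
    by apply/seteqP; split => x /= xA i; [move=> _|]; exact: xA.
  apply: fin_bigcap_measurable => // i _; rewrite -[X in measurable X]setTI.
  exact: measurable_tnth.
Qed.

Lemma lebesgue_Rd_box (R : realType) (d : nat)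
    (A : 'I_d -> set (measurableTypeR R)) : (forall i, measurable (A i)) ->
  lebesgue_Rd [set x : Rd R d | forall i, A i (tnth x i)] =
  \prod_(i < d) lebesgue_measure (A i).
Proof.
move=> mA; rewrite -lebesgue_borel_box//; apply: measurable_mu_extE.
rewrite (_ : [set _ | _] = \bigcap_(i in [set: 'I_d])
  ((@tnth d _ ^~ i) @^-1` A i)); last first.
  by apply/seteqP; split => x /= xA i; [move=> _|]; exact: xA.
apply: fin_bigcap_measurable => // i _; rewrite -[X in measurable X]setTI.
exact: measurable_tnth.
Qed.

Section bochner.
Context {R : realType} {d : nat} {B : completeNormedModType R}.
Local Notation mu := (@lebesgue_Rd R d).
Implicit Types (f : Rd R d -> B) (F : set (Rd R d -> B)) (p : R).

(* The value 0 is exempted from the finite-measure requirement: R^d is not of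
   finite measure, so no function at all would be simple otherwise. *)
Definition simple_function f :=
  finite_set (range f) /\
  forall b, b != 0%R ->
    measurable (f @^-1` [set b]) /\ mu (f @^-1` [set b]) < +oo.

Definition bochner_measurable f :=
  exists s : (Rd R d -> B)^nat, (forall n, simple_function (s n)) /\
    {ae mu, forall x, s ^~ x @ \oo --> f x}.

Definition bochner_norm p f : \bar R := Lnorm mu p%:E (fun x => `|f x|%:E).

Definition bochner_Lp p : set (Rd R d -> B) :=
  [set f | bochner_measurable f /\ bochner_norm p f < +oo].

(* Functions are not quotiented by almost everywhere equality, so this is only a
   pseudodistance. *)
Definition bochner_dist p f1 f2 : \bar R := bochner_norm p (f1 \- f2)%R.

Definition Lp_equivanishing p F := forall e : R, (0 < e)%R ->
  \forall r \near +oo%R, forall f, F f ->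
    \int[mu]_(x in [set x | (r < euclidean_norm x)%R]) (`|f x| `^ p)%:E < e%:E.

Definition Lp_equicontinuous p F := forall e : R, (0 < e)%R ->
  exists2 delta : R, (0 < delta)%R & forall h : Rd R d,
    (euclidean_norm h < delta)%R ->
    forall f, F f -> bochner_dist p (f \o translate h) f < e%:E.

End bochner.

Section gauged_cone.
Context {R : realType} {B : completeNormedModType R}.
Implicit Types (X : set B) (g : B -> R).

Definition cone X :=
  X !=set0 /\ forall (a : R) x, (0 <= a)%R -> X x -> X (a *: x)%R.

(* Only the values of g on X matter. *)
Definition gauge X g :=
  [/\ forall x, X x -> (0 <= g x)%R,
      forall (a : R) x, (0 <= a)%R -> X x -> (g (a *: x) = a * g x)%R &
      forall x, X x -> x != 0%R -> (0 < g x)%R].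

Definition seq_precompact (A : set B) := forall u : B^nat,
  (forall n, A (u n)) ->
  exists2 k : nat -> nat, {homo k : m n / (m < n)%N} & cvgn (u \o k).

Definition compactly_gauged_cone X g :=
  [/\ cone X, gauge X g & seq_precompact [set x | X x /\ (g x <= 1)%R]].

Context {d : nat}.
Local Notation mu := (@lebesgue_Rd R d).

Definition gauge_norm (p : R) g (f : Rd R d -> B) : \bar R :=
  Lnorm mu p%:E (fun x => (g (f x))%:E).

Definition gauge_Lp (p : R) X g : set (Rd R d -> B) :=
  [set f | [/\ forall x, X (f x), bochner_measurable f,
    measurable_fun [set: Rd R d] (g \o f) &
    \int[mu]_x (g (f x) `^ p)%:E < +oo]].

End gauged_cone.

Section total_boundedness.
Context {R : realType} {S : Type}.
Variable dist : S -> S -> \bar R.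

Definition diameter (A : set S) : \bar R :=
  ereal_sup [set dist x y | x in A & y in A].

(* F is totally bounded as a subset of the space with underlying set E. *)
Definition totally_bounded_in (E F : set S) := forall e : R, (0 < e)%R ->
  exists n (U : 'I_n -> set S),
    [/\ forall i, U i `<=` E, forall i, diameter (U i) < e%:E &
        F `<=` \bigcup_i U i].

End total_boundedness.

(* Main.v *)
From HB Require Import structures.
Require Import Defs.
From mathcomp Require Import all_boot all_order all_algebra.
From mathcomp Require Import all_classical all_reals all_analysis.
From mathcomp Require Import measurable_realfun.
From mathcomp Require Import ring lra.

Set Implicit Arguments.
Unset Strict Implicit.
Unset Printing Implicit Defensive.

Import Order.TTheory GRing.Theory Num.Theory.
Import numFieldNormedType.Exports.

Local Open Scope classical_set_scope.
Local Open Scope ring_scope.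

(** A function [f] of the family is approximated in [L^p] by a function that
    is constant on the cells of a grid of small cubes and takes there values
    of [f] itself. Sampling [f], rather than averaging it, keeps the
    approximation in the cone [X] although [X] need not be convex, and
    dispenses with vector-valued integrals.

    That good sample points exist is an averaging argument. Let the cells
    [Q_k] have volume [q], so that the differences of two points of one cell
    lie in a cube [D] of volume [2^d q]. By Tonelli's theorem and translation
    invariance ([cells_oscillation_le]),

      [sum_k int_(Q_k) int_(Q_k) |f(x) - f(z)|^p dx dz <=
         int_D (int |f(x + h) - f(x)|^p dx) dh <= 2^d q eta]

    as soon as [eta] bounds the inner integral on [D]; equicontinuity provides
    such a bound, uniformly in the family, when the cubes are small. Since
    [int <<f>>^p <= M] as well, one can choose in every cell a point [z_k] for
    which, simultaneously, the sum over [k] of [int_(Q_k) |f(x) - f(z_k)|^p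
    dx] is at most a constant times [eta] and every [<<f(z_k)>>^p] is at most
    a constant times [M / q] ([exists_samples]).

    By equivanishing the grid need only cover a ball, so that finitely many
    cells suffice. The sampled values lie in a sublevel set of the gauge,
    which is contained in a multiple of the precompact set [<<x>> <= 1] and
    hence has a finite [tau]-net ([gauge_sublevel_net]). Replacing each value by a nearby
    point of the net leaves only finitely many step functions, and the family
    is covered by small balls around them ([gauge_Lp_approximation],
    [bochner_dist_le]).

    Tonelli's theorem requires joint measurability of [f(x + h) - f(x)] in [x]
    and [h], which may fail when [f] is only Lebesgue measurable. Hence [f] is
    first set to 0 on a Borel null set outside which it is a pointwise limit
    of Borel step functions ([borel_representative]); 0 belongs to the cone,
    so that the modified function still takes values in [X]. *)

(** * Step functions and strong measurability *)

(** Measurability of the fibers is what makes every image and every pair of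
    step functions measurable. Measurability for the Borel sets of the
    codomain would not do: in a nonseparable Banach space, the difference of
    two Borel functions need not be Borel. *)
Definition step_function d (T : measurableType d) (V : Type) (f : T -> V) :=
  finite_set (range f) /\ forall v, measurable (f @^-1` [set v]).

Definition strongly_measurable (R : realType) d (T : measurableType d)
    (V : normedModType R) (f : T -> V) :=
  exists2 s : nat -> T -> V, forall n, step_function (s n) &
    forall x, s ^~ x @ \oo --> f x.

Section step_functions.
Context d (T : measurableType d).

Lemma step_preimage (V : Type) (f : T -> V) (A : set V) :
  step_function f -> measurable (f @^-1` A).
Proof.
move=> [ff mf].
rewrite (_ : _ @^-1` _ = \bigcup_(v in range f `&` A) f @^-1` [set v]).
  by apply: fin_bigcup_measurable => //; exact: finite_setIl.
apply/seteqP; split => [x Ax|x [v [_ Av] /= ->]]//.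
by exists (f x) => //; split => //; exists x.
Qed.

Lemma step_comp (V W : Type) (phi : V -> W) (f : T -> V) :
  step_function f -> step_function (phi \o f).
Proof.
move=> sf; split.
  by have [ff _] := sf; rewrite -(image_comp f phi); exact: finite_image.
by move=> w; rewrite comp_preimage; exact: step_preimage.
Qed.

Lemma step_pair (V W : Type) (f : T -> V) (g : T -> W) :
  step_function f -> step_function g -> step_function (fun x => (f x, g x)).
Proof.
move=> sf sg; split.
  have [[ff _] [fg _]] := (sf, sg).
  apply: (sub_finite_set _ (finite_setX ff fg)).
  by move=> _ [x _ <-]; split; exists x.
move=> [v w]; rewrite (_ : _ @^-1` _ = f @^-1` [set v] `&` g @^-1` [set w]).
  by apply: measurableI; exact: step_preimage.
by apply/seteqP; split => x /= [-> ->].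
Qed.

Lemma step_measurable_fun d' (T' : measurableType d') (f : T -> T') :
  step_function f -> measurable_fun setT f.
Proof. by move=> sf _ A _; rewrite setTI; exact: step_preimage. Qed.

Lemma step_cst (V : Type) (v : V) : step_function (fun _ : T => v).
Proof.
split; first by apply: (sub_finite_set _ (finite_set1 v)) => _ [x _ <-].
by move=> w; rewrite preimage_cst; case: ifP.
Qed.

End step_functions.

Lemma step_precomp d1 d2 (T1 : measurableType d1) (T2 : measurableType d2)
    (V : Type) (u : T1 -> T2) (f : T2 -> V) :
  measurable_fun setT u -> step_function f -> step_function (f \o u).
Proof.
move=> mu sf; split.
  have [ff _] := sf.
  by apply: (sub_finite_set _ ff) => _ [x _ <-]; exists (u x).
move=> v; rewrite comp_preimage -[X in measurable X]setTI.
exact: mu measurableT _ (step_preimage _ sf).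
Qed.

Section strong_measurability.
Context (R : realType) d (T : measurableType d) (V : normedModType R).
Implicit Types f g : T -> V.

Lemma strongly_measurable_step f : step_function f -> strongly_measurable f.
Proof. by move=> sf; exists (fun=> f) => // x; exact: cvg_cst. Qed.

Lemma strongly_measurableB f g : strongly_measurable f ->
  strongly_measurable g -> strongly_measurable (f \- g).
Proof.
move=> [s ss sf] [t st tg]; exists (fun n => s n \- t n).
  move=> n; exact: (step_comp (fun z => z.1 - z.2) (step_pair (ss n) (st n))).
by move=> x; apply: cvgB; [exact: sf|exact: tg].
Qed.

Lemma strongly_measurable_norm f : strongly_measurable f ->
  measurable_fun setT (fun x => `|f x|).
Proof.
move=> [s ss sf]; apply: (@measurable_fun_cvg _ _ _ _ (fun n x => `|s n x|)).
  by move=> n; apply: step_measurable_fun; exact: (step_comp Num.norm (ss n)).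
by move=> x _; apply: cvg_norm; exact: sf.
Qed.

End strong_measurability.

Lemma strongly_measurable_precomp (R : realType) d1 d2 (T1 : measurableType d1)
    (T2 : measurableType d2) (V : normedModType R) (u : T1 -> T2) (f : T2 -> V) :
  measurable_fun setT u -> strongly_measurable f -> strongly_measurable (f \o u).
Proof.
move=> mu [s ss sf]; exists (fun n => s n \o u) => [n|x]; last exact: sf.
exact: step_precomp.
Qed.

(** * Borel representatives of Lebesgue measurable functions *)

Section borel_lebesgue.
Context {R : realType} {d : nat}.
Local Notation E := (d.-tuple (measurableTypeR R)).
Local Notation lam := (lebesgue_borel R d).
Local Notation mu := (@lebesgue_Rd R d).

Lemma borel_measurable_Rd (A : set E) :
  measurable A -> measurable (A : set (Rd R d)).
Proof. exact: caratheodory_measurable_mu_ext. Qed.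

Lemma lebesgue_RdE (A : set E) : measurable A -> mu A = lam A.
Proof. exact: measurable_mu_extE. Qed.

Lemma lebesgue_Rd_complete : measure_is_complete mu.
Proof. exact: measure_is_complete_caratheodory. Qed.

Lemma borel_measurable_fun_Rd d' (T' : measurableType d') (f : E -> T') :
  measurable_fun setT f -> measurable_fun setT (f : Rd R d -> T').
Proof.
move=> mf _ A mA; apply: borel_measurable_Rd.
by have := mf measurableT A mA.
Qed.

Lemma ge0_integral_borel (D : set E) (f : E -> \bar R) :
  measurable D -> measurable_fun setT f -> (forall x, 0 <= f x)%E ->
  (\int[mu]_(x in D) f x = \int[lam]_(x in D) f x)%E.
Proof.
move=> mD mf f0.
have mid : measurable_fun setT (fun x : Rd R d => x : E).
  exact: (borel_measurable_fun_Rd (@measurable_id _ _ _)).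
have := ge0_integral_pushforward mid (@lebesgue_Rd R d) mD
  (measurable_funTS mf) (fun x _ => f0 x).
move=> <-; apply: eq_measure_integral => A mA _.
by rewrite /= /pushforward lebesgue_RdE.
Qed.

(** The infimum defining the outer measure is attained by the intersection of
    countable covers that are nearly optimal. *)
Lemma borel_hull (A : set (Rd R d)) :
  exists B : set E, [/\ measurable B, A `<=` B & mu B = mu A].
Proof.
have [Aoo|Aoo] := eqVneq (mu A) +oo%E.
  exists setT; split => //; apply/eqP; rewrite Aoo -leye_eq -Aoo.
  exact: le_outer_measure.
have Afin : mu A \is a fin_num by rewrite ge0_fin_numE ?lt_neqAle ?Aoo ?leey.
have cover n : exists F, @measurable_cover _ E A F /\
    (\sum_(k <oo) lam (F k) < mu A + (n.+1%:R^-1)%:E)%E.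
  have n0 : (0 < n.+1%:R^-1 :> R) by rewrite invr_gt0.
  by have [_ [F ? <-] ?] := lb_ereal_inf_adherent n0 Afin; exists F.
have /choice[F FP] := cover.
exists (\bigcap_n \bigcup_k F n k).
have mB : measurable (\bigcap_n \bigcup_k F n k).
  apply: bigcapT_measurable => n; apply: bigcupT_measurable => k.
  by have [[+ _] _] := FP n; exact.
have AB : A `<=` \bigcap_n \bigcup_k F n k.
  by move=> x Ax n _; have [[_ +] _] := FP n; exact.
split => //; apply/eqP; rewrite eq_le; apply/andP.
split; last exact: le_outer_measure.
apply/lee_addgt0Pr => e e0.
near \oo => n.
apply: (@le_trans _ _ (\sum_(k <oo) lam (F n k))%E); last first.
  apply: (le_trans (ltW (FP n).2)); rewrite leeD2l// lee_fin ltW//.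
  by near: n; exact: near_infty_natSinv_lt (PosNum e0).
apply: ereal_inf_lbound; exists (F n) => //; split.
  by have [[]] := FP n.
by move=> x; exact.
Unshelve. all: by end_near. Qed.

Lemma negligible_borel_hull (N : set (Rd R d)) : mu.-negligible N ->
  exists B : set E, [/\ measurable B, lam B = 0%E & N `<=` B].
Proof.
move=> [A [mA A0 NA]]; have [B [mB AB muB]] := borel_hull A.
exists B; split => //.
  exact: etrans (esym (lebesgue_RdE mB)) (etrans muB A0).
exact: subset_trans AB.
Qed.

(** Finiteness of the measure is what turns equality of the measures of [A]
    and of its hull into negligibility of the difference. *)
Lemma finite_measure_borel (A : set (Rd R d)) :
  measurable A -> (mu A < +oo)%E ->
  exists2 B : set E, measurable B & A `<=` B /\ mu.-negligible (B `\` A).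
Proof.
move=> mA Aoo; have [B [mB AB muB]] := borel_hull A.
have mB' := borel_measurable_Rd mB.
exists B => //; split => //; apply/negligibleP; first exact: measurableD.
have Boo : (mu B < +oo)%E by rewrite (muB : mu B = _).
have /= := measureD mB' mA Boo; rewrite setIidr// => ->.
by rewrite (muB : mu B = _) subee// ge0_fin_numE.
Qed.

Definition vanish_on (B : normedModType R) (N : set E) (f : E -> B) x :=
  if x \in N then 0 else f x.

(** The level sets of the approximating simple functions away from 0 have finite
    measure, hence are Borel up to null sets. A single Borel null set contains
    all these countably many defects together with the points of divergence. *)
Lemma borel_representative (B : completeNormedModType R) (f : Rd R d -> B) :
  bochner_measurable f -> exists N : set E,
  [/\ measurable N, lam N = 0%E & strongly_measurable (vanish_on N f)].
Proof.
move=> [s [ss sf]].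
have hull n b : exists C : set E, measurable C /\ (b != 0 ->
    s n @^-1` [set b] `<=` C /\ mu.-negligible (C `\` s n @^-1` [set b])).
  have [->|b0] := eqVneq b 0; first by exists set0; split.
  have [mb boo] := (ss n).2 b b0.
  by have [C mC CP] := finite_measure_borel mb boo; exists C; split.
have /choice[C] : forall n, exists C : B -> set E, forall b, measurable (C b) /\
  (b != 0 -> s n @^-1` [set b] `<=` C b /\
    mu.-negligible (C b `\` s n @^-1` [set b])).
  by move=> n; have /choice[C CP] := hull n; exists C.
move=> CP.
(* where the Borel hulls of the nonzero level sets of [s n] are too large *)
pose bad n := \bigcup_(b in range (s n) `\ 0) (C n b `\` s n @^-1` [set b]).
have bad0 n : mu.-negligible (bad n).
  have fs : finite_set (range (s n) `\ 0).
    by apply: finite_setD; exact: (ss n).1.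
  rewrite /bad -bigsetU_fset_set// big_seq; elim/big_ind : _ => [||b].
  - exact: negligible_set0.
  - by move=> ? ?; exact: negligibleU.
  - by rewrite in_fset_set// => /set_mem[_ /eqP b0]; exact: ((CP n b).2 b0).2.
have [N [mN N0 badN]] := negligible_borel_hull
  (negligibleU sf (negligible_bigcup bad0)).
exists N; split => //; exists (fun n => vanish_on N (s n)).
  move=> n; have fs := (ss n).1.
  have mfib b : b != 0 -> measurable (vanish_on N (s n) @^-1` [set b]).
    move=> b0; have [[y _ syb]|nb] := pselect (range (s n) b).
      rewrite (_ : _ @^-1` _ = C n b `\` N).
        by apply: measurableD => //; exact: (CP n b).1.
      have [sC _] := (CP n b).2 b0.
      apply/seteqP; split => x; rewrite /vanish_on /=.
        case: ifPn => [_ /esym/eqP|]; first by rewrite (negbTE b0).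
        by rewrite notin_setE => xN sxb; split => //; exact: sC.
      move=> [Cx Nx]; rewrite memNset//; apply: contrapT => sxb; apply: Nx.
      by apply: badN; right; exists n => //; exists b => //; split;
        [exists y|exact/eqP].
    (* values not taken by [s n] do not enter [bad n], so that their hull,
       though null, need not be contained in [N] *)
    rewrite (_ : _ @^-1` _ = set0)//; apply/seteqP; split => x //.
    rewrite /vanish_on /=; case: ifPn => [_ /esym/eqP|_ sxb]; last first.
      by apply: nb; exists x.
    by rewrite (negbTE b0).
  split.
    apply: (@sub_finite_set _ _ (0 |` range (s n))); last first.
      by rewrite finite_setU; split => //; exact: finite_set1.
    move=> _ [x _ <-]; rewrite /vanish_on; case: ifPn => _; first by left.
    by right; exists x.
  move=> b; have [->|/mfib//] := eqVneq b 0.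
  rewrite (_ : _ @^-1` _ =
    ~` \bigcup_(b in range (s n) `\ 0) (vanish_on N (s n) @^-1` [set b])).
    apply/measurableC/fin_bigcup_measurable; first exact: finite_setD.
    by move=> c [_ /eqP]; exact: mfib.
  apply/seteqP; split => x /=.
    by move=> fx0 [c [_ c0] /=]; rewrite fx0 => /esym.
  apply: contra_notP => fx0; exists (vanish_on N (s n) x) => //; split => //.
  by move: fx0; rewrite /vanish_on; case: ifPn => // _ _; exists x.
move=> x; rewrite /vanish_on; case: ifPn => xN.
  exact: cvg_cst.
apply: contrapT => Nx; move: xN; apply/negP/negPn/mem_set.
by apply: badN; left.
Qed.

End borel_lebesgue.

(** * Translation invariance of the Lebesgue measure *)

Lemma lebesgue_measure_translate (R : realType) (a : R)
    (A : set (measurableTypeR R)) : measurable A ->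
  lebesgue_measure ((fun x => x + a) @^-1` A) = lebesgue_measure A.
Proof.
move=> mA.
have mt : measurable_fun setT
    ((fun x => x + a) : measurableTypeR R -> measurableTypeR R).
  exact: measurable_funD.
pose shift : {mfun (measurableTypeR R) >-> (measurableTypeR R)} :=
  HB.pack ((fun x => x + a) : measurableTypeR R -> measurableTypeR R)
    (@isMeasurableFun.Build _ _ _ _ _ mt).
apply/esym/(@lebesgue_measure_unique R
  (pushforward (@lebesgue_measure R) shift)) => //= _ [[b c] _ <-].
rewrite /pushforward /=.
rewrite (_ : _ @^-1` _ = `](b - a), (c - a)]%classic); last first.
  by apply/seteqP; split => x /=; rewrite !in_itv/= ltrBlDr lerBrDr.
rewrite !lebesgue_measure_itv/= !lte_fin ltrD2r -!EFinB.
by rewrite opprB addrA subrK.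
Qed.

Lemma ge0_integral_invariant d (T : measurableType d) (R : realType)
    (mu : {measure set T -> \bar R}) (u : T -> T) (f : T -> \bar R) :
  measurable_fun setT u ->
  (forall A, measurable A -> mu (u @^-1` A) = mu A) ->
  measurable_fun setT f -> (forall x, 0 <= f x)%E ->
  (\int[mu]_x f (u x) = \int[mu]_x f x)%E.
Proof.
move=> mu_ uA mf f0.
have := ge0_integral_pushforward mu_ mu measurableT mf (fun x _ => f0 x).
rewrite preimage_setT => <-; apply: eq_measure_integral => A mA _; exact: uA.
Qed.

Section translation.
Context {R : realType}.

Lemma tnth_translate d (h x : Rd R d) i :
  tnth (translate h x) i = tnth x i + tnth h i.
Proof. by rewrite tnth_mktuple. Qed.

Lemma measurable_translate d : measurable_fun setT
  (fun z : d.-tuple (measurableTypeR R) * d.-tuple (measurableTypeR R) =>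
    translate z.2 z.1 : d.-tuple (measurableTypeR R)).
Proof.
apply/measurable_fun_tnthP => i.
rewrite (_ : _ \o _ = fun z => tnth z.1 i + tnth z.2 i); last first.
  by apply/funext => z /=; rewrite tnth_translate.
by apply: measurable_funD; apply: (measurableT_comp (measurable_tnth i)).
Qed.

Lemma measurable_translater d (h : d.-tuple (measurableTypeR R)) :
  measurable_fun setT (translate h : d.-tuple (measurableTypeR R) ->
    d.-tuple (measurableTypeR R)).
Proof.
exact: (measurableT_comp (@measurable_translate d) (measurable_pair2 h)).
Qed.

Lemma measurable_translatel d (x : d.-tuple (measurableTypeR R)) :
  measurable_fun setT ((fun h => translate h x) : d.-tuple (measurableTypeR R) ->
    d.-tuple (measurableTypeR R)).
Proof.
exact: (measurableT_comp (@measurable_translate d) (measurable_pair1 x)).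
Qed.

Lemma translateC d (h x : Rd R d) : translate h x = translate x h.
Proof. by apply: eq_from_tnth => i; rewrite !tnth_translate addrC. Qed.

Lemma translate_cons d (h : d.+1.-tuple (measurableTypeR R)) a t :
  translate h (tuple_cons (a, t)) =
  tuple_cons (a + thead h, translate [tuple of behead h] t).
Proof.
apply: eq_from_tnth => i; rewrite tnth_translate.
case: (unliftP ord0 i) => [j ->|->]//; rewrite [h in LHS]tuple_eta !tnthS.
by rewrite tnth_translate.
Qed.

(** Induction on the dimension: the sections of a translated set along the first
    coordinate are translates, by the remaining coordinates, of sections of the
    original set. *)
Lemma lebesgue_borel_translate d (h : d.-tuple (measurableTypeR R))
    (A : set (d.-tuple (measurableTypeR R))) : measurable A ->
  lebesgue_borel R d (translate h @^-1` A) = lebesgue_borel R d A.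
Proof.
elim: d h A => [h A mA|d IH h A mA].
  congr (_ _); apply/seteqP.
  by split => x /=; rewrite [translate h x]tuple0 [x]tuple0.
pose h0 := thead h; pose h1 := [tuple of behead h].
pose B := (@tuple_cons R d) @^-1` A.
have mB : measurable B.
  by rewrite /B -[X in measurable X]setTI; exact: measurable_tuple_cons.
rewrite /= /lebesgue_cons /pushforward /product_measure1 /=.
transitivity (\int[lebesgue_measure]_(a in setT)
  (lebesgue_borel R d (xsection B (a + h0)%R)))%E.
  apply: eq_integral => a _ /=.
  rewrite -(IH h1 (xsection B (a + h0))); last exact: measurable_xsection.
  congr (_ _); apply/seteqP; split => t; rewrite /xsection /= !inE /B /=;
    by rewrite translate_cons.
have mt : measurable_fun setT
    ((fun x => x + h0) : measurableTypeR R -> measurableTypeR R).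
  exact: measurable_funD.
apply: (ge0_integral_invariant (f := lebesgue_borel R d \o xsection B) mt) => //.
- by move=> C mC; exact: lebesgue_measure_translate.
- exact: measurable_fun_xsection.
Qed.

End translation.

(** * Oscillation on cells *)

Section oscillation.
Context {R : realType} {d : nat} {B : completeNormedModType R}.
Local Notation E := (d.-tuple (measurableTypeR R)).
Local Notation lam := (lebesgue_borel R d).
Variables (p : R) (f : E -> B) (mf : strongly_measurable f).

Definition gap (z x : E) : \bar R := (`|f x - f z| `^ p)%:E.

Lemma gap_ge0 z x : (0 <= gap z x)%E.
Proof. by rewrite lee_fin powR_ge0. Qed.

Lemma measurable_gap : measurable_fun setT (fun u : E * E => gap u.1 u.2).
Proof.
apply/measurable_EFinP/(measurableT_comp (measurable_powR p)).
apply/strongly_measurable_norm/strongly_measurableB.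
  exact: strongly_measurable_precomp measurable_snd mf.
exact: strongly_measurable_precomp measurable_fst mf.
Qed.

Lemma measurable_gapr z : measurable_fun setT (gap z).
Proof. exact: (measurableT_comp measurable_gap (measurable_pair1 z)). Qed.

(** For fixed [z], substitute [x = z + h] in the inner integral and exchange
    the integrals over [z] and [h]. A pair [z], [z + h] lies in at most one
    common cell, and only if [h] is in [D], so that the sum over the cells is
    bounded by the integral over [D] of the translation error. *)
Lemma cells_oscillation_le (I : finType) (Q : I -> set E) (D : set E) (eta : R) :
  (forall k, measurable (Q k)) -> measurable D -> 0 <= eta ->
  (forall k l x, Q k x -> Q l x -> k = l) ->
  (forall k x h, Q k x -> Q k (translate h x) -> D h) ->
  (forall h, D h -> \int[lam]_x gap x (translate h x) <= eta%:E)%E ->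
  (\sum_k \int[lam]_(z in Q k) \int[lam]_(x in Q k) gap z x <= eta%:E * lam D)%E.
Proof.
move=> mQ mD eta0 Qinj QD osc.
(* the integrand in the variables [(z, x)], and in [(z, h)] where [x = z + h] *)
pose W k := (fun u : E * E => gap u.1 u.2) \_ (Q k `*` Q k).
have W0 k u : (0 <= W k u)%E.
  by rewrite /W patchE; case: ifP => // _; exact: gap_ge0.
have mW k : measurable_fun setT (W k).
  apply: (iffLR (measurable_restrictT _ (measurableX (mQ k) (mQ k)))).
  exact: measurable_funTS measurable_gap.
pose V k (u : E * E) := W k (u.1, translate u.2 u.1).
have mV k : measurable_fun setT (V k).
  apply: (measurableT_comp (mW k)).
  exact: (measurable_fun_pair measurable_fst (@measurable_translate R d)).
have V0 k u : (0 <= V k u)%E by exact: W0.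
have WV k : (\int[lam]_(z in Q k) \int[lam]_(x in Q k) gap z x =
    \int[lam]_h \int[lam]_z V k (z, h))%E.
  transitivity (\int[lam]_z \int[lam]_h V k (z, h))%E; last first.
    exact: fubini_tonelli (mV k) (V0 k).
  rewrite integral_mkcond; apply: eq_integral => z _.
  transitivity (\int[lam]_x W k (z, x))%E; last first.
    apply/esym.
    apply: (@ge0_integral_invariant _ E R lam (fun h => translate h z)
      (fun x => W k (z, x))).
    - exact: measurable_translatel.
    - move=> A mA; apply: etrans (lebesgue_borel_translate z mA).
      congr (_ _); by apply/seteqP; split => x /=; rewrite translateC.
    - exact: (measurableT_comp (mW k) (measurable_pair1 z)).
    - by move=> x; exact: W0.
  rewrite patchE; case: ifPn => zQ; last first.
    rewrite [RHS]integral0_eq// => x _; rewrite /W patchE ifF//.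
    apply/negbTE; rewrite notin_setE => -[/= Qz _].
    by move: zQ; rewrite notin_setE.
  rewrite integral_mkcond; apply: eq_integral => x _.
  rewrite /W !patchE /=; move: zQ => /set_mem zQ.
  by case: ifPn => [/set_mem xQ|]; [rewrite mem_set|rewrite notin_setE => xQ;
    rewrite memNset// => -[]].
under eq_bigr => k _ do rewrite WV.
have mG k : measurable_fun setT (fun h => \int[lam]_z V k (z, h))%E.
  exact: measurable_fun_fubini_tonelli_G (mV k) (V0 k).
rewrite -ge0_integral_sum//; last by move=> k h _; exact: integral_ge0.
apply: (@le_trans _ _ (\int[lam]_h ((cst eta%:E) \_ D) h)%E); last first.
  by rewrite -integral_mkcond integral_cst.
apply: ge0_le_integral => //.
- by move=> h _; apply: sume_ge0 => k _; exact: integral_ge0.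
- exact: emeasurable_sum.
- by apply: (iffLR (measurable_restrictT _ mD)); exact: measurable_cst.
move=> h _; rewrite -ge0_integral_sum//; last first.
  by move=> k; exact: (measurableT_comp (mV k) (measurable_pair2 h)).
rewrite patchE; case: ifPn => [/set_mem Dh|]; last first.
  rewrite notin_setE => Dh; rewrite integral0_eq// => z _.
  apply: big1 => k _; rewrite /V /W patchE ifF//; apply/negbTE.
  by rewrite notin_setE => -[/= Qz Qzh]; apply: Dh; exact: QD Qz Qzh.
apply: le_trans (osc h Dh); apply: ge0_le_integral => //.
- by move=> z _; exact: sume_ge0.
- apply: emeasurable_sum => k.
  exact: (measurableT_comp (mV k) (measurable_pair2 h)).
- exact: (measurableT_comp measurable_gap
    (measurable_fun_pair (@measurable_id _ E _) (measurable_translater h))).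
move=> z _.
have [[k Qz]|nQ] := pselect (exists k, Q k z); last first.
  rewrite big1 ?gap_ge0// => k _; rewrite /V /W patchE ifF//; apply/negbTE.
  by rewrite notin_setE => -[/= Qz _]; apply: nQ; exists k.
rewrite (bigD1 k)//= big1 ?adde0; last first.
  move=> l lk; rewrite /V /W patchE ifF//; apply/negbTE.
  rewrite notin_setE => -[/= Ql _].
  by move/eqP: lk; apply; exact: Qinj Ql Qz.
by rewrite /V /W patchE; case: ifP => // _; exact: gap_ge0.
Qed.

End oscillation.

(** * Choosing a sample point in each cell *)

Lemma ge0_integral_cells d (T : measurableType d) (R : realType)
    (mu : {measure set T -> \bar R}) (I : finType) (Q : I -> set T)
    (f : T -> \bar R) :
  (forall k, measurable (Q k)) -> (forall k l x, Q k x -> Q l x -> k = l) ->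
  measurable_fun setT f -> (forall x, 0 <= f x)%E ->
  (\int[mu]_x f x = \sum_k \int[mu]_(x in Q k) f x +
    \int[mu]_(x in ~` \bigcup_k Q k) f x)%E.
Proof.
move=> mQ Qinj mf f0.
have UQ : \big[setU/set0]_(k <- index_enum I) Q k = \bigcup_k Q k.
  rewrite -bigcup_seq; apply: eq_bigcupl; split => x //= _.
  exact: mem_index_enum.
have mU : measurable (\bigcup_k Q k) by rewrite -UQ; exact: bigsetU_measurable.
have tQ : trivIset [set` index_enum I] Q.
  by move=> k l _ _ [x [Qk Ql]]; exact: Qinj Qk Ql.
have := ge0_integral_bigsetU mu mQ (index_enum_uniq I) tQ.
rewrite /= UQ => <-; last 2 first.
- exact: measurable_funTS.
- by move=> x _.
rewrite -ge0_integral_setU//; last 3 first.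
- exact: measurableC.
- by rewrite setUv.
- exact/disj_setPCl.
by rewrite setUv.
Qed.

(** Otherwise [q Phi] would exceed the constant [int_Q Phi + zeta] on all of
    [Q], and integrating over [Q] would give [q zeta <= 0]. *)
Lemma exists_le_mean d (T : measurableType d) (R : realType)
    (mu : {measure set T -> \bar R}) (Q : set T) (q zeta : R)
    (Phi : T -> \bar R) :
  measurable Q -> mu Q = q%:E -> 0 < q -> 0 < zeta ->
  measurable_fun setT Phi -> (forall x, 0 <= Phi x)%E ->
  exists2 z, Q z & (q%:E * Phi z <= \int[mu]_(x in Q) Phi x + zeta%:E)%E.
Proof.
move=> mQ muQ q0 zeta0 mPhi Phi0; apply: contrapT => noz.
have big z : Q z -> (\int[mu]_(x in Q) Phi x + zeta%:E < q%:E * Phi z)%E.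
  by move=> Qz; rewrite ltNge; apply/negP => ?; apply: noz; exists z.
have [z0 Qz0] : Q !=set0.
  by apply/set0P/eqP => Q0; move: muQ; rewrite Q0 measure0 => -[] q_eq0;
    move: q0; rewrite -q_eq0 ltxx.
have I0 : (0 <= \int[mu]_(x in Q) Phi x)%E by exact: integral_ge0.
have Ioo : (\int[mu]_(x in Q) Phi x < +oo)%E.
  have := big _ Qz0; case: (\int[mu]_(x in Q) Phi x)%E => [r _||//].
    by rewrite ltry.
  by rewrite addye// ltNge leey.
have Ifin : (\int[mu]_(x in Q) Phi x)%E \is a fin_num by rewrite ge0_fin_numE.
suff : ((\int[mu]_(x in Q) Phi x + zeta%:E) * q%:E <=
    q%:E * \int[mu]_(x in Q) Phi x)%E.
  rewrite muleC lee_pmul2l// -[leRHS]adde0 leeD2lE// lee_fin.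
  by rewrite leNgt zeta0.
rewrite -muQ -integral_cst// muQ -ge0_integralZl//; last 2 first.
- exact: measurable_funTS.
- by rewrite lee_fin ltW.
apply: ge0_le_integral => //.
- by move=> z _; rewrite adde_ge0// lee_fin ltW.
- by apply: measurable_funTS; exact: measurable_funeM.
- by move=> z Qz; exact/ltW/big.
Qed.

Section sampling.
Context {R : realType} {d : nat} {B : completeNormedModType R}.
Local Notation E := (d.-tuple (measurableTypeR R)).
Local Notation lam := (lebesgue_borel R d).
Local Notation mu := (@lebesgue_Rd R d).
Variables (p : R) (f : E -> B) (mf : strongly_measurable f).

Lemma measurable_integral_gap (Q : set E) : measurable Q ->
  measurable_fun setT (fun z => \int[lam]_(x in Q) gap p f z x)%E.
Proof.
move=> mQ; pose W := (fun u : E * E => gap p f u.1 u.2) \_ (setT `*` Q).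
rewrite (_ : (fun z => _) = fun z => \int[lam]_x W (z, x))%E.
  apply: measurable_fun_fubini_tonelli_F.
    apply: (iffLR (measurable_restrictT _ (measurableX measurableT mQ))).
    exact: measurable_funTS (measurable_gap p mf).
  by move=> u; rewrite /W patchE; case: ifP => // _; exact: gap_ge0.
apply/funext => z; rewrite integral_mkcond; apply: eq_integral => x _.
rewrite /W !patchE; case: ifPn => [/set_mem xQ|].
  by rewrite mem_set.
by rewrite notin_setE => xQ; rewrite memNset// => -[].
Qed.

(** In each cell the nonnegative function [A k + theta q G] takes a value
    close to its mean or below. With the weight [theta = eta / M] its two
    terms have comparable totals over the grid, and a bound for the sum bounds
    each of them. *)
Lemma exists_samples (G : Rd R d -> R) (I : finType) (Q : I -> set E)
    (D : set E) (c q eta M : R) :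
  (forall k, measurable (Q k)) -> (forall k, lam (Q k) = q%:E) -> 0 < q ->
  (forall k l x, Q k x -> Q l x -> k = l) ->
  measurable D -> (lam D <= (c * q)%:E)%E ->
  (forall k x h, Q k x -> Q k (translate h x) -> D h) ->
  0 < eta ->
  (forall h, D h -> \int[lam]_x gap p f x (translate h x) <= eta%:E)%E ->
  measurable_fun setT G -> (forall x, 0 <= G x) -> 0 < M ->
  (\int[mu]_x (G x)%:E <= M%:E)%E ->
  exists z : I -> E, [/\ forall k, Q k (z k),
    (\sum_k \int[lam]_(x in Q k) gap p f (z k) x <= ((c + 2) * eta)%:E)%E &
    forall k, G (z k) <= (c + 2) * M / q].
Proof.
move=> mQ Qq q0 Qinj mD Dq QD eta0 osc mG G0 M0 intG.
have mQ' k : measurable (Q k : set (Rd R d)) by exact: borel_measurable_Rd.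
pose A k z := (\int[lam]_(x in Q k) gap p f z x)%E.
have A0 k z : (0 <= A k z)%E by apply: integral_ge0 => x _; exact: gap_ge0.
have mA k : measurable_fun setT (A k) by exact: measurable_integral_gap.
have G0' x : (0 <= (G x)%:E)%E by rewrite lee_fin.
have mG' : measurable_fun setT (fun x => (G x)%:E) by exact/measurable_EFinP.
pose theta := eta / M.
have theta0 : 0 < theta by rewrite divr_gt0.
pose Phi k (z : Rd R d) := (A k z + (theta * q)%:E * (G z)%:E)%E.
have tG0 z : (0 <= (theta * q)%:E * (G z)%:E)%E.
  by rewrite mule_ge0// lee_fin// mulr_ge0// ltW.
have mtG : measurable_fun setT (fun z => (theta * q)%:E * (G z)%:E)%E.
  exact: measurable_funeM mG'.
have Phi0 k z : (0 <= Phi k z)%E by rewrite adde_ge0.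
have mPhi k : measurable_fun setT (Phi k).
  exact: (emeasurable_funD (borel_measurable_fun_Rd (mA k)) mtG).
(* the slacks of all cells add up to at most [q eta] *)
pose zeta := q * eta / (#|I|.+1)%:R.
have zeta0 : 0 < zeta by rewrite divr_gt0// mulr_gt0.
have /choice[z zP] k : exists z, Q k z /\
    (q%:E * Phi k z <= \int[mu]_(x in Q k) Phi k x + zeta%:E)%E.
  have muQ : mu (Q k) = q%:E := etrans (lebesgue_RdE (mQ k)) (Qq k).
  have [z Qz ?] := exists_le_mean (mQ' k) muQ q0 zeta0 (mPhi k) (Phi0 k).
  by exists z.
have main : (\sum_k Phi k (z k) <= ((c + 2) * eta)%:E)%E.
  rewrite -(@lee_pmul2l _ q%:E)// ge0_sume_distrr//.
  apply: (@le_trans _ _ (\sum_k (\int[mu]_(x in Q k) Phi k x + zeta%:E))%E).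
    by apply: lee_sum => k _; exact: (zP k).2.
  rewrite big_split/=.
  have -> : (\sum_k \int[mu]_(x in Q k) Phi k x = \sum_k \int[lam]_(x in Q k) A k x
      + (theta * q)%:E * \sum_k \int[mu]_(x in Q k) (G x)%:E)%E.
    rewrite ge0_sume_distrr; last first.
      by move=> k _; apply: integral_ge0 => x _; rewrite lee_fin.
    rewrite -big_split; apply: eq_bigr => k _ /=.
    rewrite ge0_integralD; [|exact: mQ'|by []|
      exact: measurable_funTS (borel_measurable_fun_Rd (mA k))|by []|
      exact: measurable_funTS mtG].
    rewrite (ge0_integral_borel (mQ k) (mA k) (A0 k)); congr (_ + _)%E.
    rewrite ge0_integralZl; [by []|exact: mQ'|exact: measurable_funTS mG'|by []|].
    by rewrite lee_fin mulr_ge0// ltW.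
  have oscQ : (\sum_k \int[lam]_(x in Q k) A k x <= (eta * (c * q))%:E)%E.
    apply: (le_trans (cells_oscillation_le mf mQ mD (ltW eta0) Qinj QD osc)).
    by rewrite [leRHS]EFinM lee_wpmul2l// lee_fin ltW.
  have GQ : (\sum_k \int[mu]_(x in Q k) (G x)%:E <= M%:E)%E.
    apply: le_trans intG.
    rewrite (ge0_integral_cells mu mQ' Qinj mG' G0') leeDl; first by [].
    by apply: integral_ge0 => x _; exact: G0'.
  have zQ : (\sum_(k : I) zeta%:E <= (q * eta)%:E)%E.
    rewrite sumEFin lee_fin sumr_const -mulr_natr /zeta -[_ / _ * _]mulrA.
    rewrite ler_piMr//.
      by rewrite mulr_ge0// ltW.
    by rewrite mulrC ler_pdivrMr// mul1r ler_nat.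
  apply: (le_trans (leeD (leeD oscQ (lee_wpmul2l _ GQ)) zQ)).
    by rewrite lee_fin mulr_ge0// ltW.
  rewrite -!EFinM -!EFinD lee_fin /theta.
  by rewrite le_eqVlt; apply/orP; left; apply/eqP; field; exact: lt0r_neq0.
exists z; split => [k||k]; first exact: (zP k).1.
  apply: le_trans main; apply: lee_sum => k _; rewrite /Phi leeDl//.
have : ((theta * q)%:E * (G (z k))%:E <= ((c + 2) * eta)%:E)%E.
  apply: le_trans main; rewrite (bigD1 k)//=.
  by rewrite (le_trans (leeDr _ (A0 k (z k))))// leeDl// sume_ge0.
have tq0 : 0 < theta * q by rewrite mulr_gt0.
rewrite -EFinM lee_fin [_ * G _]mulrC -ler_pdivlMr// => /le_trans; apply.
by rewrite le_eqVlt; apply/orP; left; apply/eqP; rewrite /theta; field;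
  rewrite !lt0r_neq0.
Qed.

End sampling.

(** * Grids of cubes *)

Lemma increment_bound (R : realFieldType) (s u a b : R) :
  u <= a < u + s -> u <= a + b < u + s -> - s < b < s.
Proof. by move=> /andP[a1 a2] /andP[b1 b2]; apply/andP; split; lra. Qed.

Lemma interval_index (R : realType) (r s y : R) N :
  0 < s -> 2 * r < N%:R * s -> - r <= y <= r ->
  exists k : 'I_N, - r + k%:R * s <= y < - r + k.+1%:R * s.
Proof.
move=> s0 rN /andP[y1 y2].
have y0 : 0 <= (y + r) / s by apply: divr_ge0; lra.
have /andP[t1 t2] := truncn_itv y0.
have tN : (Num.truncn ((y + r) / s) < N)%N.
  by rewrite -(ltr_nat R) (le_lt_trans t1)// ltr_pdivrMr//; lra.
exists (Ordinal tN); move: t1 t2; rewrite ler_pdivlMr// ltr_pdivrMr//= => t1 t2.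
by apply/andP; split; lra.
Qed.

Section grid.
Context {R : realType} {d : nat}.
Local Notation E := (d.-tuple (measurableTypeR R)).
Local Notation lam := (lebesgue_borel R d).

Definition box (A : 'I_d -> set (measurableTypeR R)) : set E :=
  [set x | forall i, A i (tnth x i)].

Lemma measurable_box A : (forall i, measurable (A i)) -> measurable (box A).
Proof.
move=> mA; rewrite (_ : box A = \bigcap_(i in [set: 'I_d])
    ((@tnth d _ ^~ i) @^-1` A i)); last first.
  by apply/seteqP; split => x /= xA i; [move=> _|]; exact: xA.
apply: fin_bigcap_measurable => // i _; rewrite -[X in measurable X]setTI.
exact: measurable_tnth.
Qed.

Lemma box_volume (A : 'I_d -> set (measurableTypeR R)) (s : R) :
  (forall i, measurable (A i)) -> (forall i, lebesgue_measure (A i) = s%:E) ->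
  lam (box A) = (s ^+ d)%:E.
Proof.
move=> mA As; apply: etrans (lebesgue_borel_box mA) _.
under eq_bigr do rewrite As.
by rewrite prodEFin prodr_const card_ord.
Qed.

(** Half-open cubes of side [s], the grid starting at the corner of coordinates
    [- r]. *)
Definition cell (r s : R) N (k : {ffun 'I_d -> 'I_N}) : set E :=
  box (fun i => `[- r + (k i)%:R * s, - r + (k i).+1%:R * s[%classic).

Definition cube (s : R) : set E := box (fun=> `]- s, s[%classic).

Lemma measurable_cell r s N (k : {ffun 'I_d -> 'I_N}) : measurable (cell r s k).
Proof. by apply: measurable_box => i; exact: measurable_itv. Qed.

Lemma measurable_cube s : measurable (cube s).
Proof. by apply: measurable_box => i; exact: measurable_itv. Qed.

Lemma cell_volume r s N (k : {ffun 'I_d -> 'I_N}) : 0 < s ->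
  lam (cell r s k) = (s ^+ d)%:E.
Proof.
move=> s0; apply: box_volume => i; first exact: measurable_itv.
rewrite lebesgue_measure_itv/= lte_fin ltrD2l ltr_pM2r// ltr_nat ltnSn.
by rewrite -EFinB -natr1; congr EFin; ring.
Qed.

Lemma cube_volume s : 0 < s -> lam (cube s) = (2 ^+ d * s ^+ d)%:E.
Proof.
move=> s0; rewrite -exprMn; apply: box_volume => i; first exact: measurable_itv.
rewrite lebesgue_measure_itv/= lte_fin gtrN// -EFinB; congr EFin; ring.
Qed.

Lemma cell_inj r s N (k l : {ffun 'I_d -> 'I_N}) x : 0 < s ->
  cell r s k x -> cell r s l x -> k = l.
Proof.
move=> s0 kx lx; apply/ffunP => i; apply/val_inj/eqP; rewrite eqn_leq.
move: (kx i) (lx i); rewrite /= !in_itv/= => /andP[k1 k2] /andP[l1 l2].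
apply/andP; split; rewrite -ltnS -(ltr_nat R) -(ltr_pM2r s0) -(ltrD2l (- r)).
  exact: le_lt_trans k1 l2.
exact: le_lt_trans l1 k2.
Qed.

Lemma cell_translate r s N (k : {ffun 'I_d -> 'I_N}) (x h : Rd R d) :
  cell r s k x -> cell r s k (translate h x) -> cube s h.
Proof.
move=> kx khx i; move: (kx i) (khx i); rewrite /= !in_itv/= tnth_mktuple.
have -> : - r + (k i).+1%:R * s = - r + (k i)%:R * s + s by rewrite -natr1; ring.
exact: increment_bound.
Qed.

Lemma cell_cover r s N x : 0 < s -> 2 * r < N%:R * s -> euclidean_norm x <= r ->
  exists k : {ffun 'I_d -> 'I_N}, cell r s k x.
Proof.
move=> s0 rN xr.
have xi i : - r <= tnth x i <= r.
  rewrite -ler_norml -sqrtr_sqr (le_trans _ xr)// ler_wsqrtr//.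
  by rewrite (bigD1 i)//= lerDl sumr_ge0// => j _; exact: sqr_ge0.
have /choice[k kP] i := interval_index s0 rN (xi i).
by exists (finfun k) => i; rewrite /= in_itv/= ffunE; exact: kP.
Qed.

(** The crude side [s / (d + 1)] avoids a square root and covers [d = 0]. *)
Lemma cube_norm (s : R) h : 0 < s -> cube (s / d.+1%:R) h -> euclidean_norm h < s.
Proof.
move=> s0 hs; have d0 : 0 < d.+1%:R :> R by rewrite ltr0n.
rewrite -[ltRHS](ger0_norm (ltW s0)) -sqrtr_sqr ltr_sqrt ?exprn_gt0//.
apply: (@le_lt_trans _ _ (\sum_(i < d) (s / d.+1%:R) ^+ 2)).
  apply: ler_sum => i _; rewrite -real_normK ?num_real//.
  rewrite ler_sqr ?nnegrE ?divr_ge0// ?ltW// ltr_norml.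
  by move: (hs i); rewrite /= in_itv.
rewrite sumr_const card_ord expr_div_n -[ltLHS]mulr_natr -[ltLHS]mulrA.
rewrite gtr_pMr ?exprn_gt0//.
rewrite mulrC ltr_pdivrMr ?exprn_gt0// mul1r -natrX ltr_nat.
by rewrite (leq_trans (ltnSn d))// leq_pmull.
Qed.

End grid.

(** * Finite nets in compactly gauged cones *)

Section nets.
Context {R : realType} {B : completeNormedModType R}.

(** Without a finite net one could choose inductively a [tau]-separated sequence
    in [A], none of whose subsequences is Cauchy. *)
Lemma seq_precompact_net (A : set B) (tau : R) : seq_precompact A -> 0 < tau ->
  exists s : seq B, forall x, A x -> exists2 y, y \in s & `|x - y| < tau.
Proof.
move=> Acpt tau0; apply: contrapT => nonet.
have /choice[next nextP] (s : seq B) :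
    exists x, A x /\ forall y, y \in s -> tau <= `|x - y|.
  apply: contrapT => nox; apply: nonet; exists s => x Ax.
  apply: contrapT => noy; apply: nox; exists x; split => // y ys.
  by rewrite leNgt; apply/negP => xy; apply: noy; exists y.
(* [l n] lists, in reverse order, the first [n] terms of the sequence [u] *)
pose l := fix l n := if n is n'.+1 then next (l n') :: l n' else [::].
pose u n := next (l n).
have ul m n : (m < n)%N -> u m \in l n.
  elim: n => // n IH; rewrite ltnS leq_eqVlt => /predU1P[->|/IH un].
    exact: mem_head.
  by rewrite in_cons un orbT.
have sep m n : (m < n)%N -> tau <= `|u n - u m|.
  by move=> mn; have [_] := nextP (l n); apply; exact: ul.
have [k kmono ukcvg] := Acpt u (fun n => (nextP (l n)).1).
have tau20 : 0 < tau / 2 by rewrite divr_gt0.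
have /cvgrPdist_lt/(_ _ tau20)[N _ Nclose] := ukcvg.
have := sep _ _ (kmono N N.+1 (ltnSn N)); apply/negP; rewrite -ltNge.
rewrite [tau]splitr -(subrKA (limn (u \o k))) (le_lt_trans (ler_normD _ _))//.
apply: ltrD; last exact: Nclose (leqnn N).
by rewrite distrC; exact: Nclose (leqnSn N).
Qed.

Variables (X : set B) (g : B -> R) (hX : compactly_gauged_cone X g).

Lemma gauge0 : X 0 /\ g 0 = 0.
Proof.
have [[[x Xx] Xcone] [_ gZ _] _] := hX.
have X0 : X 0 by rewrite -(scale0r x); exact: Xcone.
by split => //; have := gZ 0 0 (lexx _) X0; rewrite scale0r mul0r.
Qed.

(** By homogeneity, a net of the sublevel set at height 1 can be scaled. *)
Lemma gauge_sublevel_net (L tau : R) : 0 < L -> 0 < tau ->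
  exists s : seq B, forall x, X x -> g x <= L -> exists2 y, y \in s & `|x - y| < tau.
Proof.
move=> L0 tau0; have [[_ Xcone] [_ gZ _] Xcpt] := hX.
have tL0 : 0 < tau / L by rewrite divr_gt0.
have [s sP] := seq_precompact_net Xcpt tL0.
exists [seq L *: y | y <- s] => x Xx gx.
have Li0 : 0 <= L^-1 by rewrite invr_ge0 ltW.
have [|y ys xy] := sP (L^-1 *: x).
  by split; [exact: Xcone|rewrite gZ// mulrC ler_pdivrMr// mul1r].
exists (L *: y); first exact: map_f.
rewrite -[x](scalerKV (lt0r_neq0 L0)) -scalerBr normrZ gtr0_norm//.
by rewrite mulrC -ltr_pdivlMr.
Qed.

End nets.

(** * Powers, norms and gauges *)

Section powers.
Context {R : realType} (p : R) (p0 : 0 < p).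

(** The constant is far from optimal, but holds for all exponents and follows
    from [u + v <= 2 max(u, v)]. *)
Lemma powR_normD (B : normedModType R) (a b : B) :
  `|a + b| `^ p <= 2 `^ p * (`|a| `^ p + `|b| `^ p).
Proof.
have max0 : 0 <= Num.max `|a| `|b| by rewrite le_max normr_ge0.
have ab : `|a + b| <= 2 * Num.max `|a| `|b|.
  by rewrite (le_trans (ler_normD _ _))// mulr_natl mulr2n lerD// le_max lexx ?orbT.
apply: (@le_trans _ _ ((2 * Num.max `|a| `|b|) `^ p)).
  by rewrite ge0_ler_powR ?nnegrE ?mulr_ge0 ?(ltW p0).
rewrite powRM// ler_wpM2l ?powR_ge0//.
by rewrite maxEle; case: ifP => _; rewrite ?lerDr ?lerDl powR_ge0.
Qed.

Lemma powRVK (a : R) : 0 <= a -> (a `^ p^-1) `^ p = a.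
Proof. by move=> a0; rewrite -powRrM mulVf ?gt_eqF// powRr1. Qed.

Lemma powRKV (a : R) : 0 <= a -> (a `^ p) `^ p^-1 = a.
Proof. by move=> a0; rewrite -powRrM mulfV ?gt_eqF// powRr1. Qed.

Lemma Lnorm_powR_le d (T : measurableType d) (mu : {measure set T -> \bar R})
    (f : T -> R) (c : R) : 0 <= c ->
  (Lnorm mu p%:E (EFin \o f) <= c%:E)%E =
  (\int[mu]_x (`|f x| `^ p)%:E <= (c `^ p)%:E)%E.
Proof.
move=> c0; have I0 : (0 <= \int[mu]_x (`|f x| `^ p)%:E)%E.
  by apply: integral_ge0 => x _; rewrite lee_fin powR_ge0.
have -> : Lnorm mu p%:E (EFin \o f) = ((\int[mu]_x (`|f x| `^ p)%:E) `^ p^-1)%E.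
  by rewrite unlock.
have pV : 0 < p^-1 by rewrite invr_gt0.
case: (\int[mu]_x _)%E I0 => [a| |]//.
  rewrite !lee_fin => a0; apply/idP/idP => ac.
    rewrite -[leLHS]powRVK// ge0_ler_powR ?nnegrE ?powR_ge0// ltW//.
  rewrite -[leRHS]powRKV// ge0_ler_powR ?nnegrE ?powR_ge0// ltW//.
by move=> _; rewrite poweRyr ?gt_eqF// !leye_eq.
Qed.

End powers.

Section gauge_bounds.
Context {R : realType} {B : completeNormedModType R}.
Variables (X : set B) (g : B -> R) (hX : compactly_gauged_cone X g).

(** The precompact set [<<x>> <= 1] is bounded, being within distance 1 of a
    finite set; homogeneity extends the bound to the cone. *)
Lemma norm_le_gauge : exists2 C : R, 0 < C & forall x, X x -> `|x| <= C * g x.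
Proof.
have [[_ Xcone] [g0 gZ gpos] _] := hX.
have [s sP] := gauge_sublevel_net hX ltr01 ltr01.
exists (1 + \sum_(y <- s) `|y|) => [|x Xx].
  by rewrite ltr_wpDr// sumr_ge0.
have [->|x0] := eqVneq x 0.
  by rewrite normr0 mulr_ge0 ?(gauge0 hX).2 // addr_ge0// sumr_ge0.
have gx := gpos x Xx x0.
have gi0 : 0 <= (g x)^-1 by rewrite invr_ge0 ltW.
have [||y ys xy] := sP ((g x)^-1 *: x).
- exact: Xcone.
- by rewrite gZ// mulVf ?gt_eqF.
rewrite -[x in `|x|](scalerKV (lt0r_neq0 gx)) normrZ gtr0_norm// mulrC.
rewrite ler_pM2r// -[_ *: x](subrK y) (le_trans (ler_normD _ _))//.
by rewrite lerD ?(ltW xy)// (big_rem y)//= lerDl sumr_ge0.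
Qed.

End gauge_bounds.

(** * Functions equal to a Borel function almost everywhere *)

Section borel_versions.
Context {R : realType} {d : nat} {B : completeNormedModType R}.
Local Notation E := (d.-tuple (measurableTypeR R)).
Local Notation lam := (lebesgue_borel R d).
Local Notation mu := (@lebesgue_Rd R d).
Implicit Types (f : Rd R d -> B).

(** Both functions have the same underlying domain, but the null set is required
    to be Borel: its translates are then again Borel null sets. *)
Definition borel_version f (f' : E -> B) := strongly_measurable f' /\
  exists N : set E, [/\ measurable N, lam N = 0%E & forall x, ~ N x -> f x = f' x].

Lemma borel_version_id f : strongly_measurable (f : E -> B) -> borel_version f f.
Proof. by move=> sf; split => //; exists set0; split => //; rewrite measure0. Qed.

Lemma borel_versionB f1 f1' f2 f2' : borel_version f1 f1' ->
  borel_version f2 f2' -> borel_version (f1 \- f2) (f1' \- f2').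
Proof.
move=> [s1 [N1 [mN1 N10 fN1]]] [s2 [N2 [mN2 N20 fN2]]].
split; first exact: strongly_measurableB.
exists (N1 `|` N2); split; first exact: measurableU.
  exact: (null_set_setU mN1 mN2 N10 N20).
by move=> x /not_orP[n1 n2] /=; rewrite fN1// fN2.
Qed.

Lemma borel_version_translate f f' h :
  borel_version f f' -> borel_version (f \o translate h) (f' \o translate h).
Proof.
move=> [sf [N [mN N0 fN]]]; split.
  exact: (strongly_measurable_precomp (measurable_translater h)).
exists (translate h @^-1` N); split.
- by rewrite -[X in measurable X]setTI; exact: (measurable_translater h).
- exact: etrans (lebesgue_borel_translate h mN) N0.
- by move=> x Nx /=; exact: fN.
Qed.

Variable p : R.

Lemma measurable_norm_powR (f' : E -> B) : strongly_measurable f' ->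
  measurable_fun setT (fun x => (`|f' x| `^ p)%:E).
Proof.
move=> sf; apply/measurable_EFinP/(measurableT_comp (measurable_powR p)).
exact: strongly_measurable_norm.
Qed.

Lemma borel_version_ae T (F : B -> T) f f' : borel_version f f' ->
  ae_eq mu setT (F \o f' : Rd R d -> T) (F \o f).
Proof.
move=> [_ [N [mN N0 fN]]]; exists N; split.
- exact: borel_measurable_Rd.
- exact: etrans (lebesgue_RdE mN) N0.
- by move=> x /= ne; apply: contrapT => Nx; apply: ne => _; rewrite fN.
Qed.

Lemma borel_version_measurable f f' : borel_version f f' ->
  measurable_fun setT (fun x : Rd R d => (`|f x| `^ p)%:E).
Proof.
move=> ff'; have := borel_version_ae (fun v => (`|v| `^ p)%:E) ff'.
move/(ae_measurable_fun (@lebesgue_Rd_complete R d)); apply.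
exact: (borel_measurable_fun_Rd (measurable_norm_powR ff'.1)).
Qed.

Lemma borel_version_integral f f' (D : set E) :
  borel_version f f' -> measurable D ->
  (\int[mu]_(x in D) (`|f x| `^ p)%:E = \int[lam]_(x in D) (`|f' x| `^ p)%:E)%E.
Proof.
move=> ff' mD; have mf' := measurable_norm_powR ff'.1.
have pow0 (x : R) : (0 <= (x `^ p)%:E)%E by rewrite lee_fin powR_ge0.
rewrite -(ge0_integral_borel mD mf' (fun x => pow0 _)).
apply: ge0_ae_eq_integral.
- exact: borel_measurable_Rd.
- exact: measurable_funTS (borel_version_measurable ff').
- exact: measurable_funTS (borel_measurable_fun_Rd mf').
- by move=> x _; exact: pow0.
- by move=> x _; exact: pow0.
apply: ae_eq_subset (@subsetT _ _) _; apply/ae_eq_sym.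
exact: borel_version_ae (fun v => (`|v| `^ p)%:E) _ _ ff'.
Qed.

Lemma bochner_measurable_version f : bochner_measurable f ->
  exists N : set E, borel_version f (vanish_on N f).
Proof.
move=> /borel_representative[N [mN N0 sN]]; exists N; split => //.
by exists N; split => // x Nx; rewrite /vanish_on memNset.
Qed.

End borel_versions.

(** * Approximation by functions constant on cells *)

Section cell_steps.
Context {R : realType} {d : nat} {B : completeNormedModType R}.
Local Notation E := (d.-tuple (measurableTypeR R)).
Local Notation lam := (lebesgue_borel R d).
Local Notation mu := (@lebesgue_Rd R d).
Context {I : finType} (Q : I -> set E) (mQ : forall k, measurable (Q k))
  (Qinj : forall k l x, Q k x -> Q l x -> k = l).

(** For disjoint cells, the choice made by [pick] is the only one possible. *)
Definition cell_step (b : I -> B) (x : E) : B :=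
  oapp b 0 [pick k | x \in Q k].

Lemma cell_stepE b k x : Q k x -> cell_step b x = b k.
Proof.
move=> Qk; rewrite /cell_step; case: pickP => [l /set_mem Ql|/(_ k)]/=.
  by rewrite (Qinj Ql Qk).
by rewrite mem_set.
Qed.

Lemma cell_step_out b x : (forall k, ~ Q k x) -> cell_step b x = 0.
Proof. by move=> nQ; rewrite /cell_step; case: pickP => [l /set_mem/nQ|]. Qed.

Lemma step_cell_step b : step_function (cell_step b).
Proof.
rewrite (_ : cell_step b = oapp b 0 \o (fun x => [pick k | x \in Q k]))//.
apply: step_comp; split; first exact: finite_finset.
have fib k : (fun x => [pick k | x \in Q k]) @^-1` [set Some k] = Q k.
  apply/seteqP; split => x /=.
    by case: pickP => // l /set_mem Ql [<-].
  move=> Qk; case: pickP => [l /set_mem Ql|/(_ k)]; first by rewrite (Qinj Ql Qk).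
  by rewrite mem_set.
case=> [k|]; first by rewrite fib.
rewrite (_ : _ @^-1` _ = ~` \bigcup_k Q k).
  by apply/measurableC/fin_bigcup_measurable => //; exact: finite_finset.
apply/seteqP; split => x /=.
  by case: pickP => // nQ _ [k _ Qk]; move: (nQ k); rewrite mem_set.
by move=> nQ; case: pickP => // k /set_mem Qk; case: nQ; exists k.
Qed.

Variables (p : R) (p0 : 0 < p).

Lemma cell_step_error (f : E -> B) (b c : I -> B) (q tau : R) :
  strongly_measurable f -> (forall k, lam (Q k) = q%:E) -> 0 <= q -> 0 <= tau ->
  (forall k, `|c k - b k| <= tau) ->
  (\int[lam]_x (`|f x - cell_step b x| `^ p)%:E <=
   (2 `^ p)%:E * (\sum_k \int[lam]_(x in Q k) (`|f x - c k| `^ p)%:E +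
     (#|I|%:R * q * tau `^ p)%:E) +
   \int[lam]_(x in ~` \bigcup_k Q k) (`|f x| `^ p)%:E)%E.
Proof.
move=> sf Qq q0 tau0 cb.
have pow0 (x : R) : (0 <= (x `^ p)%:E)%E by rewrite lee_fin powR_ge0.
have mcst (v : B) : strongly_measurable (fun _ : E => v).
  by apply: strongly_measurable_step; exact: step_cst.
have mfc (v : B) := measurable_norm_powR p (strongly_measurableB sf (mcst v)).
have mfs := measurable_norm_powR p
  (strongly_measurableB sf (strongly_measurable_step (step_cell_step b))).
rewrite (ge0_integral_cells lam mQ Qinj mfs (fun x => pow0 _)).
apply: leeD; last first.
  rewrite le_eqVlt; apply/orP; left; apply/eqP; apply: eq_integral => x /set_mem nQ.
  rewrite /= cell_step_out ?subr0// => k Qk; apply: nQ; by exists k.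
have tauE : ((#|I|%:R * q * tau `^ p)%:E =
    \sum_(k : I) (tau `^ p * q)%:E)%E.
  rewrite sumEFin sumr_const -mulr_natr; congr EFin; ring.
rewrite tauE -big_split/= ge0_sume_distrr; last first.
  move=> k _; rewrite adde_ge0 ?lee_fin ?mulr_ge0 ?powR_ge0//.
  exact: integral_ge0.
apply: lee_sum => k _.
apply: (@le_trans _ _ (\int[lam]_(x in Q k) ((2 `^ p)%:E *
    ((`|f x - c k| `^ p)%:E + (tau `^ p)%:E)))%E).
  apply: ge0_le_integral; first exact: mQ.
  - by move=> x _; exact: pow0.
  - exact: measurable_funTS mfs.
  - apply: measurable_funTS; apply: measurable_funeM; apply: emeasurable_funD => //.
    exact: mfc.
  move=> x Qk; rewrite (cell_stepE b Qk) -EFinD -EFinM lee_fin.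
  rewrite -[f x](subrK (c k)) -addrA (le_trans (powR_normD p0 _ _))//.
  rewrite ler_wpM2l ?powR_ge0// addrK lerD2l ge0_ler_powR ?nnegrE ?(ltW p0)//.
have mfck : measurable_fun (Q k) (fun x => (`|f x - c k| `^ p)%:E).
  exact: measurable_funTS (mfc (c k)).
rewrite ge0_integralZl; [|exact: mQ|exact: emeasurable_funD|
  by move=> x _; rewrite adde_ge0|by rewrite lee_fin powR_ge0].
rewrite ge0_integralD; [|exact: mQ|by move=> x _; exact: pow0|exact: mfck|
  by move=> x _; exact: pow0|exact: measurable_cst].
suff -> : (\int[lam]_(x in Q k) (tau `^ p)%:E = (tau `^ p * q)%:E)%E by [].
apply: etrans (integral_cst lam (mQ k) _) _; rewrite EFinM; congr (_ * _)%E.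
exact: Qq.
Qed.

End cell_steps.

Section approximation.
Context {R : realType} {d : nat} {B : completeNormedModType R}.
Local Notation E := (d.-tuple (measurableTypeR R)).
Local Notation lam := (lebesgue_borel R d).
Local Notation mu := (@lebesgue_Rd R d).
Variables (X : set B) (g : B -> R) (hX : compactly_gauged_cone X g).
Variables (p : R) (p0 : 0 < p).
Context {I : finType} (Q : I -> set E) (D : set E) (c q eta eta' M : R).

(** The values [v] are samples of a Borel version of [f] that still takes all
    its values in [X]. They are chosen before [b], which will be picked in a
    net that depends only on the bound obtained for the gauge of [v]. *)
Lemma gauge_Lp_approximation (f : Rd R d -> B) :
  (forall k, measurable (Q k)) -> (forall k, lam (Q k) = q%:E) -> 0 < q ->
  (forall k l x, Q k x -> Q l x -> k = l) ->
  measurable D -> (lam D <= (c * q)%:E)%E ->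
  (forall k x h, Q k x -> Q k (translate h x) -> D h) ->
  0 < eta -> 0 < M -> gauge_Lp p X g f ->
  (\int[mu]_x (g (f x) `^ p)%:E <= M%:E)%E ->
  (forall h, D h ->
    \int[mu]_x (`|f (translate h x) - f x| `^ p)%:E <= eta%:E)%E ->
  (\int[mu]_(x in ~` \bigcup_k Q k) (`|f x| `^ p)%:E <= eta'%:E)%E ->
  exists v : I -> B,
    (forall k, X (v k) /\ g (v k) `^ p <= (c + 2) * M / q) /\
    forall (b : I -> B) (tau : R), 0 <= tau ->
      (forall k, `|v k - b k| <= tau) ->
    (\int[mu]_x (`|f x - cell_step Q b x| `^ p)%:E <=
     (2 `^ p * ((c + 2) * eta + #|I|%:R * q * tau `^ p) + eta')%:E)%E.
Proof.
move=> mQ Qq q0 Qinj mD Dq QD eta0 M0 [Xf bf mgf _] gf osc out.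
have [N ff'] := bochner_measurable_version bf.
set f' := vanish_on N f in ff'.
have Xf' x : X (f' x).
  by rewrite /f' /vanish_on; case: ifP => // _; exact: (gauge0 hX).1.
pose G (x : Rd R d) := g (f' x) `^ p.
have aeG : ae_eq mu setT (EFin \o G) (fun x => (g (f x) `^ p)%:E).
  exact: borel_version_ae (fun v => (g v `^ p)%:E) _ _ ff'.
have mgfp : measurable_fun setT (fun x => (g (f x) `^ p)%:E).
  exact/measurable_EFinP/(measurableT_comp (measurable_powR p) mgf).
have mG : measurable_fun setT (EFin \o G).
  exact: (ae_measurable_fun (@lebesgue_Rd_complete R d) (ae_eq_sym aeG) mgfp).
have G0 x : 0 <= G x by exact: powR_ge0.
have gG : (\int[mu]_x (G x)%:E <= M%:E)%E.
  apply: le_trans gf; rewrite le_eqVlt; apply/orP; left; apply/eqP.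
  by apply: ge0_ae_eq_integral => // x _; rewrite lee_fin powR_ge0.
have osc' h : D h -> (\int[lam]_x gap p f' x (translate h x) <= eta%:E)%E.
  move=> Dh; apply: le_trans (osc h Dh).
  by rewrite (borel_version_integral p (borel_versionB
    (borel_version_translate h ff') ff') measurableT).
have [z [zQ zosc zG]] := exists_samples ff'.1 mQ Qq q0 Qinj mD Dq QD eta0 osc'
  ((measurable_EFinP _ _).1 mG) G0 M0 gG.
exists (f' \o z); split => [k|b tau tau0 vb].
  by split; [exact: Xf'|exact: zG].
have fs := borel_versionB ff'
  (borel_version_id (strongly_measurable_step (step_cell_step mQ Qinj b))).
rewrite (borel_version_integral p fs measurableT).
apply: le_trans (cell_step_error mQ Qinj p0 ff'.1 Qq (ltW q0) tau0 vb) _.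
rewrite [leRHS]EFinD; apply: leeD.
  rewrite [leRHS]EFinM lee_wpmul2l ?lee_fin ?powR_ge0//.
  by rewrite [leRHS]EFinD; exact: leeD zosc (lexx _).
have mU : measurable (~` \bigcup_k Q k).
  by apply/measurableC/fin_bigcup_measurable => //; exact: finite_finset.
by rewrite -(borel_version_integral p ff' mU).
Qed.

End approximation.

(** * Distances and total boundedness in L^p *)

Section bochner_distances.
Context {R : realType} {d : nat} {B : completeNormedModType R}.
Local Notation E := (d.-tuple (measurableTypeR R)).
Local Notation mu := (@lebesgue_Rd R d).
Variables (p : R) (p0 : 0 < p).
Implicit Types f : Rd R d -> B.

Lemma bochner_norm_le f (c : R) : 0 <= c ->
  (bochner_norm p f <= c%:E)%E =
  (\int[mu]_x (`|f x| `^ p)%:E <= (c `^ p)%:E)%E.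
Proof.
move=> c0; have := Lnorm_powR_le p0 mu (fun x => `|f x|) c0.
under eq_integral do rewrite normr_id; exact.
Qed.

(** Two functions in one ball around [psi] are close to each other: this
    bounds the diameter of the covering sets without Minkowski's inequality. *)
Lemma bochner_dist_le f1 f2 (psi : E -> B) (kappa : R) : 0 <= kappa ->
  bochner_measurable f1 -> bochner_measurable f2 -> strongly_measurable psi ->
  (\int[mu]_x (`|f1 x - psi x| `^ p)%:E <= kappa%:E)%E ->
  (\int[mu]_x (`|f2 x - psi x| `^ p)%:E <= kappa%:E)%E ->
  (bochner_dist p f1 f2 <= ((2 `^ p * (kappa + kappa)) `^ p^-1)%:E)%E.
Proof.
move=> k0 bf1 bf2 spsi close1 close2.
have pow0 (x : R) : (0 <= (x `^ p)%:E)%E by rewrite lee_fin powR_ge0.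
have [N1 v1] := bochner_measurable_version bf1.
have [N2 v2] := bochner_measurable_version bf2.
have vpsi := borel_version_id spsi.
have m1 := borel_version_measurable p (borel_versionB v1 vpsi).
have m2 := borel_version_measurable p (borel_versionB v2 vpsi).
have m12 := borel_version_measurable p (borel_versionB v1 v2).
rewrite /bochner_dist bochner_norm_le ?powR_ge0// powRVK//; last first.
  by rewrite mulr_ge0 ?powR_ge0// addr_ge0.
apply: (@le_trans _ _ (\int[mu]_x ((2 `^ p)%:E *
    ((`|f1 x - psi x| `^ p)%:E + (`|f2 x - psi x| `^ p)%:E)))%E).
  apply: ge0_le_integral.
  - exact: measurableT.
  - by move=> x _; exact: pow0.
  - exact: m12.
  - by apply: measurable_funeM; exact: emeasurable_funD m1 m2.
  move=> x _; rewrite -EFinD -EFinM lee_fin /= -(subrKA (psi x)).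
  by rewrite (le_trans (powR_normD p0 _ _))// [`|psi x - _|]distrC.
rewrite ge0_integralZl; [|exact: measurableT|exact: emeasurable_funD m1 m2|
  by move=> x _; rewrite adde_ge0 ?pow0|by rewrite lee_fin powR_ge0].
rewrite ge0_integralD; [|exact: measurableT|by move=> x _; exact: pow0|exact: m1|
  by move=> x _; exact: pow0|exact: m2].
rewrite EFinM; apply: lee_wpmul2l; first exact: pow0.
by rewrite EFinD; exact: leeD close1 close2.
Qed.

Lemma gauge_Lp_bochner (X : set B) (g : B -> R) :
  compactly_gauged_cone X g -> gauge_Lp p X g `<=` @bochner_Lp R d B p.
Proof.
move=> hX f [Xf bf mgf gfoo]; split => //.
have [[_ _] [g0 _ _] _] := hX.
have [C C0 Cg] := norm_le_gauge hX.
have pow0 (x : R) : (0 <= (x `^ p)%:E)%E by rewrite lee_fin powR_ge0.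
have [N v] := bochner_measurable_version bf.
have mgfp : measurable_fun setT (fun x => (g (f x) `^ p)%:E).
  exact/measurable_EFinP/(measurableT_comp (measurable_powR p) mgf).
have J0 : (0 <= \int[mu]_x (g (f x) `^ p)%:E)%E.
  by apply: integral_ge0 => x _; exact: pow0.
have Jfin : (\int[mu]_x (g (f x) `^ p)%:E)%E \is a fin_num by rewrite ge0_fin_numE.
pose J := fine (\int[mu]_x (g (f x) `^ p)%:E)%E.
have CJ0 : 0 <= C `^ p * J by rewrite mulr_ge0 ?powR_ge0// fine_ge0.
apply: (@le_lt_trans _ _ ((C `^ p * J) `^ p^-1)%:E); last exact: ltry.
rewrite bochner_norm_le ?powR_ge0// powRVK// EFinM fineK//.
rewrite -ge0_integralZl; [|exact: measurableT|exact: mgfp|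
  by move=> x _; exact: pow0|exact: pow0].
apply: ge0_le_integral.
- exact: measurableT.
- by move=> x _; exact: pow0.
- exact: borel_version_measurable v.
- exact: measurable_funeM.
move=> x _; rewrite -EFinM lee_fin -powRM ?(ltW C0) ?g0//.
by rewrite ge0_ler_powR ?nnegrE ?(ltW p0) ?Cg ?mulr_ge0 ?(ltW C0) ?g0.
Qed.

End bochner_distances.

Lemma measurable_euclidean_norm (R : realType) (d : nat) :
  measurable_fun setT (@euclidean_norm R d : d.-tuple (measurableTypeR R) -> R).
Proof.
have msqrt : measurable_fun setT (@Num.sqrt R).
  by apply: continuous_measurable_fun; exact: sqrt_continuous.
apply: (measurableT_comp msqrt).
apply: measurable_sum => i; apply: measurable_funX.
exact: measurable_tnth.
Qed.

Theorem theorem2p7 (R : realType) (d : nat) (B : completeNormedModType R)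
    (p : R) (hp : 1 <= p)
    (X : set B) (g : B -> R) (hX : compactly_gauged_cone X g)
    (F : set (Rd R d -> B)) (FX : F `<=` gauge_Lp p X g)
    (Fbounded : exists M : R, forall f, F f -> (gauge_norm p g f <= M%:E)%E)
    (Fvanish : Lp_equivanishing p F) (Fcont : Lp_equicontinuous p F) :
  totally_bounded_in (bochner_dist p) (bochner_Lp p) F.
Proof.
have p0 : 0 < p by exact: lt_le_trans ltr01 hp.
have pow0 (x : R) : (0 <= (x `^ p)%:E)%E by rewrite lee_fin powR_ge0.
have two0 : 0 < 2 `^ p :> R by exact: powR_gt0.
have [M0 FM0] := Fbounded.
pose M := (`|M0| + 1) `^ p.
have M_gt0 : 0 < M by rewrite powR_gt0// ltr_wpDl.
have FM f : F f -> (\int[lebesgue_Rd (d := d)]_x (g (f x) `^ p)%:E <= M%:E)%E.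
  move=> Ff; have [Xf _ _ _] := FX f Ff; have [_ [g0 _ _] _] := hX.
  have M1 : 0 <= `|M0| + 1 by rewrite addr_ge0.
  have : (gauge_norm p g f <= (`|M0| + 1)%:E)%E.
    by rewrite (le_trans (FM0 f Ff))// lee_fin (le_trans (ler_norm _))// lerDl.
  rewrite (Lnorm_powR_le p0 _ _ M1); apply: le_trans.
  rewrite le_eqVlt; apply/orP; left; apply/eqP; apply: eq_integral => x _.
  by rewrite ger0_norm// g0.
move=> e e0.
(* chosen so that [bochner_dist_le] yields the diameter [e / 2]; the cells, the
   replacement of values by the net and the complement of the grid contribute
   [kappa / 3] each to the error *)
pose kappa := (e / 2) `^ p / (2 `^ p * 2).
have kappa0 : 0 < kappa by rewrite divr_gt0 ?powR_gt0 ?divr_gt0 ?mulr_gt0.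
pose c : R := 2 ^+ d.
have c0 : 0 < c by rewrite exprn_gt0.
pose eta := kappa / (3 * 2 `^ p * (c + 2)).
have eta0 : 0 < eta by rewrite divr_gt0// !mulr_gt0// addr_gt0.
have [delta delta0 Fdelta] := Fcont (eta `^ p^-1) (powR_gt0 _ eta0).
have kappa30 : 0 < kappa / 3 by rewrite divr_gt0.
have [r0 [_ Fr0]] := Fvanish _ kappa30.
pose r := r0 + 1.
have Fr f : F f ->
    (\int[lebesgue_Rd (d := d)]_(x in [set x | (r < euclidean_norm x)%R])
      (`|f x| `^ p)%:E < (kappa / 3)%:E)%E.
  by apply: Fr0; rewrite ltrDl.
pose s := delta / d.+1%:R.
have s0 : 0 < s by rewrite divr_gt0.
pose N := Num.bound `|2 * r / s|.
have rN : 2 * r < N%:R * s.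
  rewrite -ltr_pdivrMr// (le_lt_trans (ler_norm _))//.
  exact: archi_boundP.
pose I := {ffun 'I_d -> 'I_N}.
pose Q (k : I) := cell r s k.
pose q := s ^+ d.
have q0 : 0 < q by rewrite exprn_gt0.
have mQ k : measurable (Q k) by exact: measurable_cell.
have Qq k : lebesgue_borel R d (Q k) = q%:E by exact: cell_volume.
have Qinj k l x : Q k x -> Q l x -> k = l by exact: cell_inj.
have IQ0 : 0 <= #|I|%:R * q by rewrite mulr_ge0// ltW.
(* the summand 1 keeps the denominator positive when there are no cells *)
pose tau := (kappa / (3 * 2 `^ p * (#|I|%:R * q + 1))) `^ p^-1.
have tauarg0 : 0 < kappa / (3 * 2 `^ p * (#|I|%:R * q + 1)).
  by rewrite divr_gt0// !mulr_gt0// ltr_wpDl.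
have tau0 : 0 < tau by exact: powR_gt0.
pose L0 := (c + 2) * M / q.
have L00 : 0 < L0 by rewrite divr_gt0// mulr_gt0// addr_gt0.
have [net netP] := gauge_sublevel_net hX (powR_gt0 p^-1 L00) tau0.
pose value (J : {ffun I -> 'I_(size net)}) k := nth 0 net (J k).
pose psi J := cell_step Q (value J).
have spsi J : strongly_measurable (psi J).
  exact: strongly_measurable_step (step_cell_step mQ Qinj _).
(* one covering set for each assignment of points of the net to the cells *)
exists #|{ffun I -> 'I_(size net)}|, (fun i => [set f | bochner_Lp p f /\
  (\int[lebesgue_Rd (d := d)]_x (`|f x - psi (enum_val i) x| `^ p)%:E
     <= kappa%:E)%E]); split.
- by move=> i f [].
- move=> i; apply: (@le_lt_trans _ _ (e / 2)%:E); last first.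
    by rewrite lte_fin ltr_pdivrMr// ltr_pMr// ltr1n.
  apply: ge_ereal_sup => _ [f1 [[bf1 _] close1] [f2 [[bf2 _] close2] <-]].
  have := bochner_dist_le p0 (ltW kappa0) bf1 bf2 (spsi _) close1 close2.
  move=> /le_trans; apply.
  rewrite lee_fin (_ : 2 `^ p * (kappa + kappa) = (e / 2) `^ p).
    by rewrite powRKV// ltW// divr_gt0.
  by rewrite /kappa; field; exact: lt0r_neq0.
move=> f Ff.
have bf : bochner_Lp p f by apply: (gauge_Lp_bochner p0 hX); exact: FX.
have osc h : cube s h ->
    (\int[lebesgue_Rd (d := d)]_x (`|f (translate h x) - f x| `^ p)%:E <=
      eta%:E)%E.
  move=> hs; have := ltW (Fdelta h (cube_norm delta0 hs) f Ff).
  by rewrite /bochner_dist (bochner_norm_le p0)// ?powR_ge0// powRVK// ltW.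
have out : (\int[lebesgue_Rd (d := d)]_(x in ~` \bigcup_k Q k) (`|f x| `^ p)%:E
    <= (kappa / 3)%:E)%E.
  apply: le_trans (ltW (Fr f Ff)).
  have [Nf vf] := bochner_measurable_version bf.1.
  apply: ge0_subset_integral.
  - apply: borel_measurable_Rd; apply/measurableC/fin_bigcup_measurable => //.
    exact: finite_finset.
  - apply: borel_measurable_Rd.
    rewrite (_ : [set _ | _] = @euclidean_norm R d @^-1` `]r, +oo[%classic).
      rewrite -[X in measurable X]setTI; apply: measurable_euclidean_norm => //.
    by apply/seteqP; split => x; rewrite /= in_itv/= andbT.
  - exact: measurable_funTS (borel_version_measurable p vf).
  - by move=> x _; exact: pow0.
  move=> x nQ /=; rewrite ltNge; apply/negP => xr; apply: nQ.
  by have [k Qk] := cell_cover s0 rN xr; exists k.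
have Dq : (lebesgue_borel R d (cube s) <= (c * q)%:E)%E by rewrite (cube_volume s0).
have [v [vX vapprox]] := gauge_Lp_approximation hX p0 mQ Qq q0 Qinj
  (measurable_cube s) Dq (@cell_translate R d r s N) eta0 M_gt0
  (FX f Ff) (FM f Ff) osc out.
have /choice[J JP] k : exists j : 'I_(size net), `|v k - nth 0 net j| <= tau.
  have [Xv gv] := vX k; have [_ [g0 _ _] _] := hX.
  have gL : g (v k) <= L0 `^ p^-1.
    rewrite -[leLHS](powRKV p0) ?g0// ge0_ler_powR ?nnegrE ?powR_ge0//.
      by rewrite invr_ge0 ltW.
    exact: ltW.
  have [y ynet vy] := netP _ Xv gL.
  have jlt : (index y net < size net)%N by rewrite index_mem.
  by exists (Ordinal jlt); rewrite /= nth_index// ltW.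
exists (enum_rank (finfun J)) => //; split => //=; rewrite enum_rankK.
have close k : `|v k - value (finfun J) k| <= tau.
  by rewrite /value ffunE; exact: JP.
apply: le_trans (vapprox _ _ (ltW tau0) close) _; rewrite lee_fin.
rewrite /tau powRVK ?(ltW tauarg0)//.
have etaE : 2 `^ p * ((c + 2) * eta) = kappa / 3.
  by rewrite /eta; field; rewrite !lt0r_neq0 ?addr_gt0.
rewrite mulrDr etaE.
have tauE : 2 `^ p * (#|I|%:R * q * (kappa / (3 * 2 `^ p * (#|I|%:R * q + 1))))
    <= kappa / 3.
  rewrite (_ : 2 `^ p * _ = kappa / 3 * (#|I|%:R * q / (#|I|%:R * q + 1))).
    rewrite ler_piMr ?(ltW kappa30)// ler_pdivrMr ?ltr_wpDl// mul1r lerDl//.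
  by field; rewrite !lt0r_neq0 ?ltr_wpDl.
by move: tauE; lra.
Qed.
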